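(* For every $p\in(2,\infty)$ there exists a doubling subset of $L_p$ (equipped with the metric induced by the norm $\|\cdot\|_p$) that does not admit a bi-Lipschitz embedding into $\mathbb{R}^k$ for any $k\in\mathbb{N}$.
   Context: $L_p$ denotes, as usual, the Banach space $L_p([0,1])$ (Lebesgue measure, real-valued functions) with norm $\|\cdot\|_p$. Given $K\in[1,\infty)$, a metric space $X$ is $K$-doubling if every ball in $X$ (centre in $X$) can be covered by at most $K$ balls in $X$ of half its radius. $X$ is doubling if it is $K$-doubling for some $K$. A metric space $(X,d_X)$ admits a bi-Lipschitz embedding into a metric space $(Y,d_Y)$ if there are $f:X\to Y$, $s\in(0,\infty)$ and $M\in[1,\infty)$ with $s\,d_X(x,y)\le d_Y(f(x),f(y))\le Ms\,d_X(x,y)$ for all $x,y\in X$. $\mathbb{R}^k$ carries the Euclidean metric. *)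

(* Defs.v *)
From HB Require Import structures.
From mathcomp Require Import all_boot all_order all_algebra ring lra.
From mathcomp Require Import all_classical all_reals all_analysis measurable_realfun.

Set Implicit Arguments.
Unset Strict Implicit.
Unset Printing Implicit Defensive.

Import Order.TTheory GRing.Theory Num.Theory.
Import numFieldNormedType.Exports.

Local Open Scope classical_set_scope.
Local Open Scope ring_scope.

Section Lspace_metric.
Context d (T : measurableType d) (R : realType).
Variables (mu : {measure set T -> \bar R}) (p : \bar R) (p1 : (1 <= p)%E).
Local Notation Lp := (LspaceType mu p1).

(* Elements of [LspaceType mu p1] are classes modulo a.e. equality; the
   coercion to functions picks the canonical representative of a class. *)
Definition Lspace_dist (f g : Lp) : R :=
  fine ('N[mu]_p[EFin \o ((f : T -> R) \- (g : T -> R))%R])%E.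

Lemma Lspace_Lfun (f : Lp) : (f : T -> R) \in Lfun mu p.
Proof.
rewrite inE; apply/andP; split.
  apply: mem_set; exact: (@measurable_funPT _ _ _ _ (repr (f : {mfun_ mu, T >-> measurableTypeR R}))).
by rewrite inE; case: f => f [[]].
Qed.

Lemma Lspace_distE (f g : Lp) : (Lspace_dist f g)%:E =
  ('N[mu]_p[EFin \o ((f : T -> R) \- (g : T -> R))%R])%E.
Proof.
have h : (f : T -> R) - (g : T -> R) \in Lfun mu p.
  have [_ addC] := Lfun_addr_closed mu p1.
  by apply: addC; [exact: Lspace_Lfun|apply: Lfun_oppr_closed; exact: Lspace_Lfun].
exact: (finite_norm_fine (Lfun_Sub p1 h)).
Qed.

Lemma Lspace_measurable (f : Lp) : measurable_fun setT (f : T -> R).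
Proof. by have /andP[/set_mem] := Lspace_Lfun f. Qed.

Lemma Lspace_distxx f : Lspace_dist f f = 0.
Proof.
apply: EFin_inj; rewrite Lspace_distE.
rewrite (_ : EFin \o _ = cst 0%E).
  by rewrite Lnorm0// gt_eqF// (lt_le_trans _ p1).
by apply/funext => x /=; rewrite subrr.
Qed.

Lemma Lspace_dist_sym f g : Lspace_dist f g = Lspace_dist g f.
Proof.
apply: EFin_inj; rewrite !Lspace_distE -oppe_Lnorm; congr (Lnorm _ _ _).
by apply/funext => x /=; rewrite opprB.
Qed.

Lemma Lspace_dist_triangle g f h :
  Lspace_dist f h <= Lspace_dist f g + Lspace_dist g h.
Proof.
rewrite -lee_fin EFinD !Lspace_distE.
rewrite (_ : EFin \o ((f : T -> R) \- (h : T -> R)) =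
  EFin \o (((f : T -> R) \- (g : T -> R)) \+ ((g : T -> R) \- (h : T -> R)))).
  by apply: eminkowski => //; apply: measurable_funB; exact: Lspace_measurable.
by apply/funext => x /=; rewrite addrA subrK.
Qed.

Lemma Lspace_dist_positivity f g : Lspace_dist f g = 0 -> f = g.
Proof.
move=> fg0; have /Lnorm_eq0_eq0 : 'N[mu]_p[EFin \o
    ((f : T -> R) \- (g : T -> R))%R]%E = 0%E by rewrite -Lspace_distE fg0.
have mfg : measurable_fun setT ((f : T -> R) \- (g : T -> R)).
  by apply: measurable_funB; exact: Lspace_measurable.
move=> /(_ ((measurable_EFinP _ _).2 mfg) (lt_le_trans lte01 p1)) fgae.
have fg : (f : {mfun_ mu, T >-> measurableTypeR R}) = g.
  apply/eqP; rewrite -[X in X == _]reprK -[X in _ == X]reprK.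
  rewrite eqmodE; apply/asboolP; apply: filterS fgae => x /= H.
  move=> _; move: (H I) => [] fgx; exact: (subr0_eq fgx).
case: f g fg {fg0 mfg fgae} => f [[Pf]] [g [[Pg]]] /= fg.
by move: Pf Pg; rewrite fg => Pf Pg; rewrite (Prop_irrelevance Pf Pg).
Qed.

HB.instance Definition _ := gen_eqMixin Lp.
HB.instance Definition _ := gen_choiceMixin Lp.
HB.instance Definition _ := isMetric.Build R Lp Lspace_distxx
  Lspace_dist_positivity Lspace_dist_sym Lspace_dist_triangle.

End Lspace_metric.

Section Lp01.
Variable R : realType.

(* Lebesgue measure on [0, 1], as a measure on the real line carried by
   [0, 1]: values of functions outside [0, 1] are irrelevant. *)
Definition lebesgue01 : {measure set (measurableTypeR R) -> \bar R} :=
  mrestr (@lebesgue_measure R) (measurable_itv `[0%R, 1%R]).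

Definition Lp01 (p : R) (p1 : (1 <= p%:E)%E) : metricType R :=
  LspaceType lebesgue01 p1.

Lemma lee1_gt2 (p : R) : 2 < p -> (1 <= p%:E)%E.
Proof. by move=> p2; rewrite lee_fin; lra. Qed.

End Lp01.

Section subset_metric.
Context {R : realType} {X : metricType R} (A : set X).

Let sub_dist (x y : A) : R := mdist (set_val x) (set_val y).

Let sub_dist_positivity x y : sub_dist x y = 0 -> x = y.
Proof. by move=> /mdist_positivity/val_inj. Qed.

Let sub_ballE (x : A) (e : R) : ball x e = [set y | sub_dist x y < e].
Proof. by rewrite -initial_ballE ballEmdist. Qed.

HB.instance Definition _ := @PseudoMetric_isMetric.Build R (set_type A)
  sub_dist (fun x y => mdist_ge0 _ _) sub_dist_positivity sub_ballE.

End subset_metric.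

(* An alias of ['rV[R]_k], whose library metric is the sup metric. *)
Definition euclidean (R : realType) (k : nat) : Type := 'rV[R]_k.

Section euclidean_metric.
Context (R : realType) (k : nat).
Implicit Types x y z : 'rV[R]_k.

Definition euclidean_dist (x y : euclidean R k) : R :=
  Num.sqrt (\sum_(i < k) ((x : 'rV[R]_k) 0 i - (y : 'rV[R]_k) 0 i) ^+ 2).

Lemma euclidean_distxx x : euclidean_dist x x = 0.
Proof.
rewrite /euclidean_dist big1 ?sqrtr0// => i _.
by rewrite subrr expr0n.
Qed.

Lemma euclidean_dist_positivity x y : euclidean_dist x y = 0 -> x = y.
Proof.
move=> /eqP; rewrite sqrtr_eq0 => le0; apply/rowP => i.
have /eqP : \sum_(i < k) (x 0 i - y 0 i) ^+ 2 = 0.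
  by apply/eqP; rewrite eq_le le0 sumr_ge0// => j _; exact: sqr_ge0.
rewrite psumr_eq0 => [|j _]; last exact: sqr_ge0.
by move=> /allP/(_ i (mem_index_enum _)); rewrite sqrf_eq0 subr_eq0 => /eqP.
Qed.

Lemma euclidean_dist_sym x y : euclidean_dist x y = euclidean_dist y x.
Proof.
by congr Num.sqrt; apply: eq_bigr => i _; rewrite -sqrrN opprB.
Qed.

Lemma cauchy_schwarz_sum (a b : 'I_k -> R) :
  (\sum_i a i * b i) ^+ 2 <= (\sum_i a i ^+ 2) * (\sum_i b i ^+ 2).
Proof.
set u := \sum_i a i ^+ 2; set v := \sum_i b i ^+ 2; set w := \sum_i a i * b i.
have v0 : 0 <= v by apply: sumr_ge0 => i _; exact: sqr_ge0.
have E : \sum_i (v * a i - w * b i) ^+ 2 = v * (u * v - w ^+ 2).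
  transitivity (\sum_i (v ^+ 2 * a i ^+ 2 +
      (- (2 * v * w) * (a i * b i) + w ^+ 2 * b i ^+ 2))).
    by apply: eq_bigr => i _; ring.
  by rewrite !big_split/= -!mulr_sumr -/u -/v -/w; ring.
have [v_gt0|] := ltP 0 v.
  rewrite -subr_ge0 -(pmulr_rge0 _ v_gt0) -E.
  by apply: sumr_ge0 => i _; exact: sqr_ge0.
move=> vle; have /eqP : v = 0 by apply/eqP; rewrite eq_le vle v0.
rewrite psumr_eq0 => [/allP b0|i _]; last exact: sqr_ge0.
rewrite (_ : w = 0); last first.
  apply: big1 => i _; have := b0 i (mem_index_enum _).
  by rewrite sqrf_eq0 => /eqP ->; rewrite mulr0.
by rewrite expr0n/= mulr_ge0// sumr_ge0// => i _; exact: sqr_ge0.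
Qed.

Lemma euclidean_dist_triangle y x z :
  euclidean_dist x z <= euclidean_dist x y + euclidean_dist y z.
Proof.
rewrite /euclidean_dist.
pose a i := x 0 i - y 0 i; pose b i := y 0 i - z 0 i.
rewrite (eq_bigr (fun i => (a i + b i) ^+ 2)) => [|i _]; last first.
  by rewrite /a /b addrA subrK.
rewrite -/(a _) -[X in Num.sqrt X + _]/(\sum_i a i ^+ 2).
rewrite -[X in _ + Num.sqrt X]/(\sum_i b i ^+ 2).
set u := \sum_i a i ^+ 2; set v := \sum_i b i ^+ 2.
have u0 : 0 <= u by apply: sumr_ge0 => i _; exact: sqr_ge0.
have v0 : 0 <= v by apply: sumr_ge0 => i _; exact: sqr_ge0.
pose w := \sum_i a i * b i.
have -> : \sum_i (a i + b i) ^+ 2 = u + 2 * w + v.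
  rewrite /u /v /w mulr_sumr -!big_split/=.
  by apply: eq_bigr => i _; ring.
have wle : w <= Num.sqrt u * Num.sqrt v.
  rewrite -sqrtrM// (le_trans (ler_norm _))// -sqrtr_sqr.
  by apply: ler_wsqrtr; exact: cauchy_schwarz_sum.
rewrite -[leRHS]ger0_norm ?addr_ge0 ?sqrtr_ge0// -sqrtr_sqr.
apply: ler_wsqrtr; rewrite sqrrD !sqr_sqrtr//; lra.
Qed.

HB.instance Definition _ := Choice.on (euclidean R k).
HB.instance Definition _ := isMetric.Build R (euclidean R k) euclidean_distxx
  euclidean_dist_positivity euclidean_dist_sym euclidean_dist_triangle.

End euclidean_metric.

Section doubling_and_embeddings.
Context {R : realType}.

(* [ball] is the open ball. A ball is given by its centre and radius, and the
   covering balls of half the radius are listed by their centres in [s]. *)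
Definition K_doubling (K : R) (X : metricType R) : Prop :=
  forall (x : X) (r : R), 0 < r ->
    exists s : seq X, (size s)%:R <= K /\
      ball x r `<=` \bigcup_(c in [set` s]) ball c (r / 2).

Definition doubling (X : metricType R) : Prop :=
  exists K : R, 1 <= K /\ K_doubling K X.

Definition bilipschitz_embeds (X Y : metricType R) : Prop :=
  exists (f : X -> Y) (s M : R), 0 < s /\ 1 <= M /\
    forall x y : X, s * mdist x y <= mdist (f x) (f y) <= M * s * mdist x y.

End doubling_and_embeddings.

(* Main.v *)
Require Import Defs.
From HB Require Import structures.
From mathcomp Require Import all_boot all_order all_algebra ring lra zify.
From mathcomp Require Import all_classical all_reals all_analysis.
From mathcomp Require Import measurable_realfun.

Set Implicit Arguments.
Unset Strict Implicit.
Unset Printing Implicit Defensive.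

Import Order.TTheory GRing.Theory Num.Theory.
Import numFieldNormedType.Exports.

Local Open Scope classical_set_scope.
Local Open Scope ring_scope.

(** The doubling set is a thin Laakso-type fractal inside a copy of l_p carried
    by step functions on disjoint intervals J_0, J_1, ... of [0, 1]. The point
    with time t and bits s takes the value t on J_0 and s_i tent_i(t) on
    J_(i+1), where tent_i(t) = 4^-i tent(4^i t) is 1-Lipschitz and vanishes
    within 4^-i / 4 of the multiples of 4^-i. Put eps_i = |J_(i+1)|^(1/p). Since
    p > 2, the lengths can be summable while eps_i ~ i^(-1/2), so that the sum
    of the eps_i^2 diverges. For fixed s the point depends on t in a 1-Lipschitz
    way, because the values of the step function do and [0, 1] has measure 1.

    At level i every segment of length 4^-i splits into a diamond of width
    comparable to 4^-i eps_i in its middle half. The parallelogram law in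
    Euclidean space then shows that the squared stretch of a bi-Lipschitz map on
    some segment of level i + 1 exceeds the one on a given segment of level i by
    a fixed multiple of eps_i^2; these increments have infinite sum.

    For the doubling property, fix a ball of radius r and compare r with
    4^-i eps_i. The bits of the levels where 4^-i eps_i is small have a total
    effect of order r. At the levels where it is large, a bit can differ from
    that of the centre only where tent_i is small, and by self-similarity it is
    zero throughout the ball except possibly for one level. So the time, up to
    r / 4, and five bits determine a point of the ball up to distance r / 2. *)

(** * Norms and distances in L_p *)

Section Lnorm_extra.
Context d (T : measurableType d) (R : realType).
Variables (mu : {measure set T -> \bar R}) (p : R) (p0 : 0 < p).

Let measurable_normpowR (h : T -> R) : measurable_fun setT h ->
  measurable_fun setT (fun u => (`|h u| `^ p)%:E).
Proof.
move=> mh; apply/measurable_EFinP; apply: (measurableT_comp (measurable_powR p)).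
exact: measurableT_comp.
Qed.

Lemma le_Lnorm (f g : T -> R) : measurable_fun setT f -> measurable_fun setT g ->
  (forall u, `|f u| <= `|g u|) ->
  ('N[mu]_p%:E[EFin \o f] <= 'N[mu]_p%:E[EFin \o g])%E.
Proof.
move=> mf mg fg; rewrite unlock /=; apply: gt0_ler_poweR.
- by rewrite invr_ge0 ltW.
- by rewrite in_itv/= leey andbT integral_ge0// => u _; exact: poweR_ge0.
- by rewrite in_itv/= leey andbT integral_ge0// => u _; exact: poweR_ge0.
apply: ge0_le_integral => //.
- exact: measurable_normpowR.
- exact: measurable_normpowR.
- by move=> u _; rewrite lee_fin ge0_ler_powR// ?nnegrE// ltW.
Qed.

Lemma ae_eq_Lnorm (f g : T -> R) : measurable_fun setT f -> measurable_fun setT g ->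
  f = g %[ae mu] ->
  ('N[mu]_p%:E[EFin \o f] = 'N[mu]_p%:E[EFin \o g])%E.
Proof.
move=> mf mg fg; rewrite unlock /=; congr (_ `^ _)%E.
apply: ge0_ae_eq_integral => //.
- exact: measurable_normpowR.
- exact: measurable_normpowR.
- by apply: filterS fg => u /= + _ => /(_ I) ->.
Qed.

Lemma Lnorm_indic (J : set T) (c w : R) : measurable J -> mu J = w%:E ->
  ('N[mu]_p%:E[EFin \o (fun u => (c * \1_J u)%R)] = (`|c| * w `^ p^-1)%:E)%E.
Proof.
move=> mJ muJ.
have w0 : 0 <= w by rewrite -lee_fin -muJ.
rewrite unlock /=.
have E u : `|c * \1_J u| `^ p = `|c| `^ p * \1_J u.
  rewrite normrM powRM// indicE; case: (u \in J).
    by rewrite normr1 powR1.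
  by rewrite normr0 powR0// gt_eqF.
under eq_integral do rewrite E EFinM.
rewrite integralZl//; last first.
  apply/integrableP; split; first exact/measurable_EFinP.
  under eq_integral do rewrite gee0_abs ?lee_fin//.
  by rewrite integral_indic// setIT muJ ltry.
rewrite integral_indic// setIT muJ -EFinM poweR_EFin powRM ?powR_ge0//.
by rewrite -powRrM mulfV ?gt_eqF// powRr1.
Qed.

End Lnorm_extra.

(** * Elements of L_p from explicit functions *)

Section mkLspace.
Context d (T : measurableType d) (R : realType).
Variables (mu : {measure set T -> \bar R}) (p : R) (p1 : (1 <= p%:E)%E).
Local Open Scope quotient_scope.

Let fpi (f : {mfun T >-> measurableTypeR R}) :=
  (\pi_({mfun_ mu, T >-> measurableTypeR R}) f : {mfun_ mu, T >-> measurableTypeR R}).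

(** An element of [LspaceType] carries a finiteness proof for its canonical representative, which
    equals [f] only almost everywhere; [ae_eq_Lnorm] transfers finiteness to it. *)
Lemma Lspace_of_Lfun (f : T -> R) : f \in Lfun mu p%:E ->
  exists g : LspaceType mu p1, (g : T -> R) = f %[ae mu].
Proof.
move=> fL.
have mf : measurable_fun setT f by move: fL => /andP[/set_mem].
pose F : {mfun T >-> measurableTypeR R} :=
  HB.pack f (@isMeasurableFun.Build d _ T (measurableTypeR R) f mf).
have FE : (fpi F : T -> R) = f %[ae mu].
  have /eqmodP := reprK (fpi F).
  rewrite /= => /asboolP; exact.
have mF : measurable_fun setT (fpi F : T -> R).
  exact: (@measurable_funPT _ _ _ _ (repr (fpi F))).
have Ffin : finite_norm mu p%:E (fpi F).
  rewrite /finite_norm (@ae_eq_Lnorm _ _ _ _ _ _ f)//.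
  by move: fL => /andP[_ /set_mem].
pose G : LspaceType mu p1 := HB.pack (fpi F) (@isFinLebesgue.Build _ _ _ mu p%:E p1 (fpi F) Ffin).
by exists G.
Qed.

Lemma Lspace_dist_ae (f g : LspaceType mu p1) (f' g' : T -> R) :
  f' \in Lfun mu p%:E -> g' \in Lfun mu p%:E ->
  (f : T -> R) = f' %[ae mu] -> (g : T -> R) = g' %[ae mu] ->
  ((mdist f g)%:E = 'N[mu]_p%:E[EFin \o (f' \- g')%R])%E.
Proof.
move=> f'L g'L ff' gg'; rewrite [LHS]Lspace_distE.
have mf : measurable_fun setT f' by move: f'L => /andP[/set_mem].
have mg : measurable_fun setT g' by move: g'L => /andP[/set_mem].
apply: ae_eq_Lnorm.
- exact: measurable_funB (Lspace_measurable f) (Lspace_measurable g).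
- exact: measurable_funB.
- by apply: filterS2 ff' gg' => u + + _ => /(_ I)/= -> /(_ I)/= ->.
Qed.
End mkLspace.

(** * Step functions on disjoint intervals *)

Section step_functions.
Variables (R : realType) (w : nat -> R).
Hypotheses (w_ge0 : forall i, 0 <= w i) (sum_w : forall n, \sum_(i < n) w i <= 1).

Let bnd n := \sum_(i < n) w i.

Let bndS n : bnd n.+1 = bnd n + w n.
Proof. by rewrite /bnd big_ord_recr. Qed.

Let bnd_homo : {homo bnd : m n / (m <= n)%N >-> m <= n}.
Proof. by apply: homo_leq => [//|y x z|i]; [exact: le_trans|rewrite bndS lerDl]. Qed.

Let bnd_ge0 n : 0 <= bnd n.
Proof. exact: sumr_ge0. Qed.

Definition step_itv i : set R := `]bnd i, bnd i.+1]%classic.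

Lemma measurable_step_itv i : measurable (step_itv i).
Proof. exact: measurable_itv. Qed.

Lemma lebesgue01_step_itv i : lebesgue01 R (step_itv i) = (w i)%:E.
Proof.
transitivity (@lebesgue_measure R (step_itv i `&` `[0, 1]%classic)); first by [].
rewrite setIidl; last first.
  move=> u; rewrite /step_itv/= !in_itv/= => /andP[bu ub].
  by rewrite (le_trans (bnd_ge0 i) (ltW bu)) (le_trans ub (sum_w _)).
rewrite /step_itv lebesgue_measure_itv/= lte_fin bndS ltrDl.
case: ifPn => [_|]; first by rewrite -EFinB addrAC subrr add0r.
by rewrite -leNgt => w0; congr EFin; apply/eqP; rewrite eq_le w_ge0 w0.
Qed.

Lemma step_itv_inj i j u : step_itv i u -> step_itv j u -> i = j.
Proof.
rewrite /step_itv/= !in_itv/= => /andP[iu ui] /andP[ju uj].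
apply/eqP; rewrite eqn_leq; apply/andP; split; rewrite leqNgt; apply/negP => ij.
- by have := lt_le_trans iu (le_trans uj (bnd_homo ij)); rewrite ltxx.
- by have := lt_le_trans ju (le_trans ui (bnd_homo ij)); rewrite ltxx.
Qed.

Definition stepfun n (c : nat -> R) (u : R) : R :=
  \sum_(i < n) c i * \1_(step_itv i) u.

Lemma measurable_stepfun n c : measurable_fun setT (stepfun n c).
Proof.
rewrite /stepfun; apply: measurable_sum => i; apply: measurable_funM => //.
exact: (measurable_indic (measurable_step_itv _)).
Qed.

Lemma stepfunE n c i u : (i < n)%N -> step_itv i u -> stepfun n c u = c i.
Proof.
move=> ilt iu; rewrite /stepfun (bigD1 (Ordinal ilt))//= indicE mem_set// mulr1.
rewrite big1 ?addr0// => j /eqP ji; rewrite indicE memNset ?mulr0// => ju.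
by apply: ji; apply: val_inj => /=; exact: step_itv_inj ju iu.
Qed.

Lemma stepfun_eq0 n c u : (forall i, (i < n)%N -> ~ step_itv i u) ->
  stepfun n c u = 0.
Proof.
move=> nu; rewrite /stepfun big1// => j _; rewrite indicE memNset ?mulr0//.
exact: nu.
Qed.

Lemma normr_stepfun_le n c B u : 0 <= B -> (forall i, (i < n)%N -> `|c i| <= B) ->
  `|stepfun n c u| <= B.
Proof.
move=> B0 cB; have [[i [ilt iu]]|nu] := pselect (exists i, (i < n)%N /\ step_itv i u).
  by rewrite (stepfunE _ ilt iu) cB.
by rewrite stepfun_eq0 ?normr0// => i ilt iu; apply: nu; exists i.
Qed.

Variables (p : R) (p0 : 0 < p).
Local Notation N f := ('N[lebesgue01 R]_p%:E[EFin \o f])%E.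

Let Lnorm_step_itv c i :
  (N (fun u => (c * \1_(step_itv i) u)%R) = (`|c| * w i `^ p^-1)%:E)%E.
Proof.
exact: (@Lnorm_indic _ _ _ (lebesgue01 R) _ p0 _ c _ (measurable_step_itv i)
  (lebesgue01_step_itv i)).
Qed.

(** Cutting the function off outside one interval can only decrease its absolute value. *)
Lemma Lnorm_stepfun_ge n c i : (i < n)%N ->
  ((`|c i| * w i `^ p^-1)%:E <= N (stepfun n c))%E.
Proof.
move=> ilt; rewrite -Lnorm_step_itv.
apply: le_Lnorm => //.
- by apply: measurable_funM => //; exact: (measurable_indic (measurable_step_itv _)).
- exact: measurable_stepfun.
move=> u; rewrite indicE; have [/set_mem iu|] := boolP (u \in step_itv i).
  by rewrite mulr1 (stepfunE _ ilt iu).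
by rewrite mulr0 normr0.
Qed.

(** The measure has total mass 1, so the norm is at most the supremum. *)
Lemma Lnorm_stepfun_le n c B : 0 <= B -> (forall i, (i < n)%N -> `|c i| <= B) ->
  (N (stepfun n c) <= B%:E)%E.
Proof.
move=> B0 cB.
have m1 : lebesgue01 R setT = 1%:E.
  transitivity (@lebesgue_measure R (setT `&` `[0, 1]%classic)); first by [].
  rewrite setTI lebesgue_measure_itv/= lte_fin ltr01.
  by rewrite -EFinB subr0.
have /= := @Lnorm_indic _ _ _ (lebesgue01 R) _ p0 _ B _ measurableT m1.
rewrite powR1 mulr1 ger0_norm// => <-; apply: le_Lnorm => //.
- exact: measurable_stepfun.
- by apply: measurable_funM => //; exact: measurable_indic.
move=> u; rewrite indicT mulr1 (ger0_norm B0).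
exact: normr_stepfun_le.
Qed.

Lemma Lnorm_stepfun_le_sum n c : 1 <= p ->
  (N (stepfun n c) <= (\sum_(i < n) `|c i| * w i `^ p^-1)%:E)%E.
Proof.
move=> p1; elim: n => [|n IH].
  by rewrite big_ord0; exact: (@Lnorm_stepfun_le 0 c 0).
rewrite big_ord_recr/= EFinD.
rewrite (_ : EFin \o stepfun n.+1 c =
  ((EFin \o stepfun n c) \+ (EFin \o (fun u => c n * \1_(step_itv n) u)%R))%E); last first.
  by apply/funext => u /=; rewrite /stepfun big_ord_recr.
have mn : measurable_fun setT (fun u => c n * \1_(step_itv n) u)%R.
  by apply: measurable_funM => //; exact: (measurable_indic (measurable_step_itv _)).
have := @eminkowski _ _ _ (lebesgue01 R) (stepfun n c)
  (fun u => c n * \1_(step_itv n) u) p%:E (measurable_stepfun n c) mn.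
rewrite lee_fin => /(_ p1) /le_trans; apply.
apply: leeD => //.
by rewrite Lnorm_step_itv.
Qed.

End step_functions.

(** * Finite sequences as elements of L_p *)

Section step_embedding.
Variables (R : realType) (w : nat -> R).
Hypotheses (w_ge0 : forall i, 0 <= w i) (sum_w : forall n, \sum_(i < n) w i <= 1).
Variables (p : R) (p1 : (1 <= p%:E)%E).

Lemma stepfun_Lfun n c : stepfun w n c \in Lfun (lebesgue01 R) p%:E.
Proof.
have p0 : 0 < p by rewrite (lt_le_trans ltr01)// -lee_fin.
rewrite inE; apply/andP; split; apply/mem_set; first exact: measurable_stepfun.
rewrite /=/finite_norm; apply: le_lt_trans (ltry (\sum_(i < n) `|c i|)).
apply: Lnorm_stepfun_le => // [|i ilt]; first exact: sumr_ge0.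
by rewrite (bigD1 (Ordinal ilt))//= lerDl sumr_ge0.
Qed.

Definition step_class (x : seq R) : Lp01 p1 :=
  sval (cid (Lspace_of_Lfun p1 (stepfun_Lfun (size x) (nth 0 x)))).

(** Entries past the end of a sequence read as 0, so any common bound [n] on the lengths gives the
    same step functions. *)
Lemma mdist_step_classE x y n : (maxn (size x) (size y) <= n)%N ->
  ((mdist (step_class x) (step_class y))%:E =
   'N[lebesgue01 R]_p%:E[EFin \o stepfun w n (fun i => x`_i - y`_i)%R])%E.
Proof.
rewrite geq_max => /andP[xn yn]; rewrite /step_class.
case: cid => /= f fx; case: cid => /= g gy.
have widen z : (size z <= n)%N ->
    stepfun w (size z) (nth 0 z) = stepfun w n (nth 0 z).
  move=> zn; apply/funext => u; rewrite /stepfun.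
  rewrite (big_ord_widen n (fun i => z`_i * \1_(step_itv w i) u))//.
  rewrite big_mkcond/=; apply: eq_bigr => i _.
  by case: ltnP => // zi; rewrite nth_default// mul0r.
rewrite (Lspace_dist_ae _ _ fx gy); [|exact: stepfun_Lfun..].
congr (Lnorm _ _ _); apply/funext => u /=; congr EFin.
rewrite !widen// /stepfun -sumrB; apply: eq_bigr => i _.
by rewrite mulrBl.
Qed.

Let p0 : 0 < p.
Proof. by rewrite (lt_le_trans ltr01)// -lee_fin. Qed.

Lemma mdist_step_class_ge x y i :
  `|x`_i - y`_i| * w i `^ p^-1 <= mdist (step_class x) (step_class y).
Proof.
rewrite -lee_fin.
(* [i.+1] enters the maximum so that coordinate [i] is counted even beyond both lengths. *)
rewrite (@mdist_step_classE x y (maxn i.+1 (maxn (size x) (size y)))) ?leq_maxr//.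
apply: (Lnorm_stepfun_ge w_ge0 sum_w p0 (fun i => x`_i - y`_i)).
by rewrite leq_maxl.
Qed.

Lemma mdist_step_class_le x y B : (forall i, `|x`_i - y`_i| <= B) ->
  mdist (step_class x) (step_class y) <= B.
Proof.
move=> xyB; rewrite -lee_fin (mdist_step_classE (leqnn _)).
apply: (Lnorm_stepfun_le w_ge0 p0) => //.
exact: le_trans (xyB 0%N).
Qed.

Lemma mdist_step_class_le_sum x y n : (maxn (size x) (size y) <= n)%N ->
  mdist (step_class x) (step_class y) <= \sum_(i < n) `|x`_i - y`_i| * w i `^ p^-1.
Proof.
move=> /mdist_step_classE xyn; rewrite -lee_fin xyn.
apply: (Lnorm_stepfun_le_sum w_ge0 sum_w p0 n (fun i => x`_i - y`_i)).
by rewrite -lee_fin.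
Qed.

End step_embedding.

(** * Summable lengths whose p-th roots are not square-summable *)

Section weights.
Variable R : realType.

(** Combines [1 + y <= expR y] with [ln (1 - x) <= - x]. *)
Lemma bernoulli_powRN (x b : R) : 0 <= b -> 0 < x < 1 -> 1 + b * x <= (1 - x) `^ (- b).
Proof.
move=> b0 /andP[x0 x1]; rewrite /powR gt_eqF ?subr_gt0//.
apply: le_trans (expR_ge1Dx _); rewrite lerD2l mulNr -mulrN ler_wpM2l//.
by rewrite lerNr le_ln1Dx// ltrN2.
Qed.

Lemma harmonic_unbounded (C : R) : exists n, C < \sum_(i < n) (i.+2%:R)^-1.
Proof.
apply: contrapT => /forallNP nC; apply: (@dvg_harmonic R).
apply: nondecreasing_is_cvgn.
  apply/nondecreasing_seqP => n; rewrite /series/= big_nat_recr//= lerDl.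
  exact: harmonic_ge0.
(* The harmonic series starts at 1 and the sum here at 1/2, whence [1 + C]. *)
exists (1 + C) => _ [n _ <-]; case: n => [|n].
  rewrite /series/= big_geq// addr_ge0//.
  by have /negP := nC 0%N; rewrite big_ord0 -leNgt.
rewrite /series/= big_mkord big_ord_recl/= /harmonic/= invr1 lerD2l leNgt.
exact/negP/nC.
Qed.

(** Lengths proportional to [(i+2)^(-p/2)] are summable because [p/2 > 1], while their powers [2/p]
    are proportional to [1/(i+2)]. The total 1/2 leaves room for J_0. *)
Lemma exists_weights (p : R) : 2 < p -> exists w : nat -> R,
  [/\ forall i, 0 < w i, forall i, w i.+1 <= w i,
      forall n, \sum_(i < n) w i <= 2^-1 &
      forall C, exists n, C < \sum_(i < n) (w i `^ p^-1) ^+ 2].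
Proof.
move=> p2; have p0 : 0 < p by lra.
pose b := p / 2 - 1; have b0 : 0 < b by rewrite /b; lra.
pose w i : R := b / 2 * i.+2%:R `^ (- (p / 2)).
have i0 i : 0 < i.+1%:R :> R by rewrite ltr0n.
exists w; split.
- by move=> i; rewrite /w mulr_gt0 ?powR_gt0// divr_gt0.
- move=> i; rewrite /w ler_pM2l ?divr_gt0// !powRN lef_pV2 ?posrE ?powR_gt0//.
  by rewrite ge0_ler_powR ?nnegrE ?ler_nat// divr_ge0// ltW.
(* Telescoping: [bernoulli_powRN] at [x = 1/(n+2)] bounds [w n] by half of
   [(n+1)^(-b) - (n+2)^(-b)]. *)
- move=> n; suff : \sum_(i < n) w i <= 2^-1 * (1 - n.+1%:R `^ (- b)).
    by move=> /le_trans; apply; rewrite ler_piMr ?invr_ge0// gerBl powR_ge0.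
  elim: n => [|n IH]; first by rewrite big_ord0 powR1 subrr mulr0.
  rewrite big_ord_recr/=; apply: le_trans (lerD IH (lexx _)) _.
  have x01 : 0 < (n.+2%:R : R)^-1 < 1.
    by rewrite invr_gt0 i0/= invf_lt1 ?i0// ltr1n.
  have := bernoulli_powRN (ltW b0) x01.
  have x1 : 0 <= 1 - (n.+2%:R : R)^-1 by rewrite subr_ge0 ltW//; case/andP: x01.
  rewrite -(ler_pM2l (powR_gt0 (- b) (i0 n.+1))) -powRM//.
  rewrite (mulrBr n.+2%:R) mulr1 divff ?gt_eqF// -[X in X - 1]natr1 addrK.
  rewrite /w; have -> : - (p / 2) = - b + -1 by rewrite /b; lra.
  rewrite powRD; last by rewrite pnatr_eq0 implybT.
  rewrite (powRN _ 1) powRr1//.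
  set A := n.+2%:R `^ _; set B := n.+1%:R `^ _; set C := _^-1; nra.
- move=> C; have k0 : 0 < (b / 2) `^ (2 / p) by rewrite powR_gt0// divr_gt0.
  have [n nC] := harmonic_unbounded (C / (b / 2) `^ (2 / p)).
  exists n; move: nC; rewrite ltr_pdivrMr// mulrC mulr_sumr => /lt_le_trans; apply.
  apply: ler_sum => i _.
  rewrite -powR_mulrn ?powR_ge0// -[(w i `^ _) `^ _]powRrM.
  rewrite /w [X in _ <= X]powRM ?powR_ge0 ?divr_ge0 ?(ltW b0)//.
  rewrite -[X in _ <= _ * X]powRrM (mulrC p^-1).
  have -> : - (p / 2) * (2 / p) = -1 by field; rewrite gt_eqF.
  by rewrite powR_inv1.
Qed.

End weights.

(** * The tent function *)

Section dist_int.
Variable R : realType.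
Implicit Types u v : R.

Definition dist_int u : R :=
  Num.min (u - (Num.floor u)%:~R) ((Num.floor u)%:~R + 1 - u).

Lemma dist_int_le u (z : int) : dist_int u <= `|u - z%:~R|.
Proof.
rewrite /dist_int ge_min; apply/orP.
have [uz|zu] := leP z%:~R u.
  left; rewrite ger0_norm ?subr_ge0// lerD2l lerN2.
  by rewrite ler_int floor_ge_int.
right; rewrite ltr0_norm ?subr_lt0// opprB lerD2r.
by rewrite -(intrD _ _ 1) ler_int lezD1 floor_lt_int.
Qed.

Lemma dist_int_eq u : exists z : int, dist_int u = `|u - z%:~R|.
Proof.
have /andP[fu uf] := floor_itv u.
rewrite /dist_int minEle; case: ifP => _.
  by exists (Num.floor u); rewrite ger0_norm// subr_ge0.
by exists (Num.floor u + 1); rewrite ltr0_norm ?opprB ?intrD// subr_lt0 -intrD.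
Qed.

Lemma dist_int_lipschitz u v : dist_int u <= dist_int v + `|u - v|.
Proof.
have [z ->] := dist_int_eq v; apply: le_trans (dist_int_le u z) _.
rewrite [leRHS]addrC; have := ler_normD (u - v) (v - z%:~R).
by rewrite addrA subrK.
Qed.

Lemma dist_int_mulrn n u : dist_int (n%:R * u) <= n%:R * dist_int u.
Proof.
have [z ->] := dist_int_eq u; apply: le_trans (dist_int_le _ (n%:Z * z)) _.
by rewrite intrM -mulrBr normrM ger0_norm ?ler0n.
Qed.

Lemma dist_int_le12 u : dist_int u <= 2^-1.
Proof.
rewrite /dist_int; move: (Num.floor u)%:~R => f.
by have [h|h] := leP (u - f) (f + 1 - u); lra.
Qed.

Lemma dist_int_half (q : nat) : dist_int (q%:R + 2^-1) = 2^-1.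
Proof.
apply/eqP; rewrite eq_le dist_int_le12/=.
have [z ->] := dist_int_eq (q%:R + 2^-1).
have [zq|qz] := leP z (q%:Z).
  have : z%:~R <= q%:~R :> R by rewrite ler_int.
  by rewrite -pmulrn => h; rewrite ger0_norm; lra.
have : (q%:Z + 1)%:~R <= z%:~R :> R by rewrite ler_int lezD1.
by rewrite intrD -pmulrn => h; rewrite ler0_norm; lra.
Qed.

(** Subtracting 1/4 confines the support to the middle halves of the unit intervals. *)
Definition tent u : R := Num.max 0 (dist_int u - 4^-1).

Lemma tent_ge0 u : 0 <= tent u.
Proof. by rewrite /tent le_max lexx. Qed.

Lemma tent_le u : tent u <= 4^-1.
Proof. by rewrite /tent ge_max; have := dist_int_le12 u; lra. Qed.

Lemma tent_lipschitz u v : `|tent u - tent v| <= `|u - v|.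
Proof.
have h a b : tent a - tent b <= `|a - b|.
  have := dist_int_lipschitz a b; have := normr_ge0 (a - b).
  by rewrite /tent /Num.max; case: ifPn; case: ifPn; rewrite -?leNgt; lra.
by rewrite ler_norml h andbT lerNl opprB distrC h.
Qed.

Lemma tent_eq0 u : dist_int u <= 4^-1 -> tent u = 0.
Proof. by move=> u4; rewrite /tent; apply/max_idPl; lra. Qed.

(* A positive value of the tent at [u] measures the distance from [u] to an odd
   multiple of 1/4. *)
Lemma dist_int_mul4_le u : 0 < tent u -> dist_int (4 * u) <= 4 * tent u.
Proof.
move=> u0; have : tent u = dist_int u - 4^-1.
  by move: u0; rewrite /tent lt_max ltxx/= => h; apply/max_idPr/ltW.
have [z ->] := dist_int_eq u => bu.
have [zu|uz] := leP z%:~R u.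
  apply: le_trans (dist_int_le _ (4 * z + 1)) _.
  move: bu; rewrite ger0_norm ?subr_ge0// intrD intrM /= => bu.
  by rewrite ger0_norm; lra.
apply: le_trans (dist_int_le _ (4 * z - 1)) _.
move: bu; rewrite ltr0_norm ?subr_lt0// intrD intrM /= => bu.
by rewrite ler0_norm; lra.
Qed.

Lemma dist_int_nat (q : nat) : dist_int q%:R = 0.
Proof.
apply/eqP; rewrite eq_le; apply/andP; split.
  by have := dist_int_le q%:R q; rewrite subrr normr0.
by have [z ->] := dist_int_eq q%:R.
Qed.

Lemma tent_nat (q : nat) : tent q%:R = 0.
Proof. by rewrite tent_eq0// dist_int_nat invr_ge0. Qed.

Lemma tent_quarter (q : nat) : tent (q%:R + 4^-1) = 0.
Proof.
rewrite tent_eq0//; have := dist_int_le (q%:R + 4^-1) q.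
by rewrite addrAC subrr add0r ger0_norm// invr_ge0.
Qed.

Lemma tent_three_quarters (q : nat) : tent (q%:R + 3 / 4) = 0.
Proof.
rewrite tent_eq0//; have := dist_int_le (q%:R + 3 / 4) (q%:Z + 1).
by rewrite intrD => /le_trans; apply; rewrite ler0_norm; lra.
Qed.

Lemma tent_half (q : nat) : tent (q%:R + 2^-1) = 4^-1.
Proof. by rewrite /tent dist_int_half; apply/eqP; rewrite eq_le ge_max le_max; lra. Qed.

Definition tent_at i (t : R) : R := 4 ^- i * tent (4 ^+ i * t).

Lemma tent_at_ge0 i t : 0 <= tent_at i t.
Proof. by rewrite mulr_ge0 ?tent_ge0// invr_ge0 exprn_ge0. Qed.

Lemma tent_at_le i t : tent_at i t <= 4 ^- i / 4.
Proof. by rewrite ler_wpM2l ?tent_le// invr_ge0 exprn_ge0. Qed.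

Lemma tent_at_lipschitz i t t' : `|tent_at i t - tent_at i t'| <= `|t - t'|.
Proof.
have p4 : 0 < 4 ^+ i :> R by rewrite exprn_gt0.
rewrite /tent_at -mulrBr normrM ger0_norm ?invr_ge0 ?(ltW p4)//.
rewrite ler_pdivrMl//; apply: le_trans (tent_lipschitz _ _) _.
by rewrite -mulrBr normrM ger0_norm ?(ltW p4).
Qed.

End dist_int.

(** * Doubling *)

(** The centres are one chosen point of the ball for each key that occurs in it. *)
Lemma doubling_of_keys (R : realType) (X : metricType R) (K : finType) (k0 : K) :
  (forall (x : X) (r : R), 0 < r -> exists key : X -> K, forall y z,
    mdist x y < r -> mdist x z < r -> key y = key z -> mdist y z < r / 2) ->
  doubling X.
Proof.
move=> keyP; exists #|K|%:R; split; first by rewrite ler1n; apply/card_gt0P; exists k0.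
move=> x r r0; have [key keyE] := keyP x r r0.
pose Q k y := mdist x y < r /\ key y = k.
pose rep k : option X := if pselect (exists y, Q k y) is left e then Some (sval (cid e)) else None.
exists (pmap rep (enum K)); split.
  by rewrite ler_nat size_pmap cardE; exact: count_size.
move=> y; rewrite ballEmdist/= => xy.
case rE : (rep (key y)) => [c|]; last first.
  by move: rE; rewrite /rep; case: pselect => // nE _; case: nE; exists y.
have [xc kc] : Q (key y) c.
  by move: rE; rewrite /rep; case: pselect => // e [<-]; case: cid.
exists c; last by rewrite ballEmdist/=; exact: keyE.
by rewrite /= mem_pmap -rE map_f// mem_enum.
Qed.

Section doubling_of_coordinates.
Variables (R : realType) (X : metricType R) (P : R -> seq bool -> X).
Variable eps : nat -> R.
Hypotheses (eps_gt0 : forall i, 0 < eps i) (eps_le1 : forall i, eps i <= 1).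
Hypothesis eps_decr : forall i, eps i.+1 <= eps i.

Local Notation crd t s i := ((nth false s i)%:R * tent_at i t).

Hypothesis P_lip : forall t t' s, mdist (P t s) (P t' s) <= `|t - t'|.
Hypothesis P_time : forall t t' s s', `|t - t'| <= 2 * mdist (P t s) (P t' s').
Hypothesis P_crd : forall t t' s s' i,
  `|crd t s i - crd t' s' i| * eps i <= mdist (P t s) (P t' s').
Hypothesis P_sum : forall t s s', mdist (P t s) (P t s') <=
  \sum_(i < maxn (size s) (size s')) `|crd t s i - crd t s' i| * eps i.

(** Changing bit [i] moves a point by at most a quarter of this, since [tent_at i] is at most
    [4 ^- i / 4]. *)
Let delta i := 4 ^- i * eps i.

Let p4 i : 0 < 4 ^+ i :> R.
Proof. by rewrite exprn_gt0. Qed.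

Let i4 i : 0 < 4 ^- i :> R.
Proof. by rewrite invr_gt0. Qed.

Let delta_gt0 i : 0 < delta i.
Proof. by rewrite mulr_gt0// invr_gt0. Qed.

Let deltaS i : delta i.+1 <= delta i / 4.
Proof.
have := eps_decr i; rewrite -(ler_pM2l (i4 i)) /delta exprS invfM.
by lra.
Qed.

Let deltaD i j : delta (i + j)%N * 4 ^+ j <= delta i.
Proof.
elim: j => [|j IH]; first by rewrite addn0 mulr1.
rewrite addnS exprS mulrA; apply: le_trans IH; rewrite ler_pM2r//.
by have := deltaS (i + j); lra.
Qed.

Let delta_le i : delta i <= 4 ^- i.
Proof. by rewrite /delta ler_piMr// invr_ge0 ltW. Qed.

Let delta_small (e : R) : 0 < e -> exists m, delta m <= e.
Proof.
move=> e0; exists (Num.truncn e^-1).+1; apply: le_trans (delta_le _) _.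
rewrite invf_ple ?posrE//.
have /andP[_ /ltW/le_trans] := truncn_itv (ltW (etrans (invr_gt0 e) e0)); apply.
by rewrite -natrX ler_nat ltnW// ltn_expl.
Qed.

Let eps_homo i j : (i <= j)%N -> eps j <= eps i.
Proof.
elim: j => [|j IH]; first by rewrite leqn0 => /eqP ->.
by rewrite leq_eqVlt ltnS => /orP[/eqP ->//|/IH]; exact: le_trans.
Qed.

Let tail_sum m n :
  \sum_(i < n) (if (i < m)%N then 0 else delta i) <= 4 / 3 * delta m.
Proof.
(* Telescoping form: by [deltaS], [delta n] is at most [4 / 3] of [delta n - delta n.+1]. *)
suff : \sum_(i < n) (if (i < m)%N then 0 else delta i) <=
    4 / 3 * (delta m - delta (maxn m n)).
  by have := delta_gt0 (maxn m n); lra.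
elim: n => [|n IH]; first by rewrite big_ord0 maxn0 subrr mulr0.
rewrite big_ord_recr/=; have [nm|mn] := ltnP n m.
  by rewrite addr0; move: IH; rewrite (maxn_idPl (ltnW nm)) (maxn_idPl nm).
move: IH; rewrite (maxn_idPr mn) (maxn_idPr (leqW mn)).
by have := deltaS n; lra.
Qed.

Let P_tail t s s' m : (forall i, (i < m)%N -> crd t s i = crd t s' i) ->
  mdist (P t s) (P t s') <= delta m / 3.
Proof.
move=> ss'; apply: le_trans (P_sum _ _ _) _.
apply: (@le_trans _ _ (4^-1 * (4 / 3 * delta m))); last by lra.
apply: le_trans (ler_wpM2l _ (tail_sum m _)); last by rewrite invr_ge0.
rewrite mulr_sumr; apply: ler_sum => i _; case: ltnP => [im|_].
  by rewrite ss'// subrr normr0 mul0r mulr0.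
rewrite /= /delta [leRHS]mulrA ler_pM2r// [leRHS]mulrC.
apply: le_trans (tent_at_le i t); rewrite -mulrBl normrM (ger0_norm (tent_at_ge0 _ _)).
rewrite ler_piMl ?tent_at_ge0//.
by do 2 case: (nth _ _ _); rewrite ?subrr ?subr0 ?sub0r ?normrN ?normr0 ?normr1.
Qed.

(** Levels, large compared with [r], where bits can differ inside the ball and still matter: the
    tent is positive, yet too small for a flip to leave the ball. *)
Let bad (t0 r : R) i := 128 * r < delta i /\
  exists t, [/\ `|t - t0| < 2 * r, 0 < tent_at i t & tent_at i t * eps i < 7 * r].

(* When [4 ^+ i * t] lies just inside the support of the tent, it is close to
   an odd multiple of 1/4, so [4 ^+ k * t] is close to an integer, where the
   tent vanishes, until the scale [r] is reached. *)
Let bad_unique t0 r i k : bad t0 r i -> bad t0 r k -> i = k.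
Proof.
suff bad_lt j l : (j < l)%N -> bad t0 r j -> bad t0 r l -> False.
  move=> bi bk; apply/eqP; rewrite eqn_leq; apply/andP.
  by split; rewrite leqNgt; apply/negP => /bad_lt; apply.
move=> jl [rj [t [tt0 bt0 bt]]] [rl [t' [tt0' bt0' _]]].
have bu : 0 < tent (4 ^+ j * t).
  by move: bt0; rewrite /tent_at pmulr_rgt0// invr_gt0.
have : dist_int (4 ^+ l * t) <= 4 ^+ (l - j) * tent (4 ^+ j * t).
  (* One factor 4 is handled by [dist_int_mul4_le], the remaining power by [dist_int_mulrn]. *)
  have -> : 4 ^+ l * t = (4 ^ (l - j.+1))%:R * (4 * (4 ^+ j * t)).
    by rewrite natrX !mulrA -!exprSr -exprD; congr (4 ^+ _ * _); lia.
  apply: le_trans (dist_int_mulrn _ _) _.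
  have -> : 4 ^+ (l - j) = (4 ^ (l - j.+1))%:R * 4 :> R.
    by rewrite natrX -exprSr; congr (_ ^+ _); lia.
  by rewrite -mulrA ler_wpM2l// dist_int_mul4_le.
set b := tent _ in bu *; move=> dt.
have eb : eps j * b < 7 * r * 4 ^+ j.
  rewrite [ltRHS]mulrC -ltr_pdivrMl//.
  by move: bt; rewrite /tent_at -/b; lra.
have rb : 128 * r * 4 ^+ l < eps l.
  by move: rl; rewrite /delta [ltRHS]mulrC ltr_pdivlMr.
have cb : 4 ^+ (l - j) * b <= 7 / 128.
  rewrite -(ler_pM2l (eps_gt0 j)).
  have := eps_homo (ltnW jl).
  have : 4 ^+ (l - j) * (eps j * b) <= 4 ^+ (l - j) * (7 * r * 4 ^+ j).
    by rewrite ler_pM2l// ltW.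
  have -> : 4 ^+ (l - j) * (7 * r * 4 ^+ j) = 7 * (r * 4 ^+ l).
    rewrite [in RHS](_ : l = (l - j + j)%N); last by rewrite subnK// ltnW.
    by rewrite exprD; ring.
  lra.
have tt' : `|4 ^+ l * t' - 4 ^+ l * t| <= 4 / 128.
  rewrite -mulrBr normrM ger0_norm ?(ltW (p4 _))//.
  have : `|t' - t| <= 4 * r.
    have := ler_distD t0 t' t; rewrite (distrC t0 t) => /le_trans; apply.
    by lra.
  move=> /(ler_wpM2l (ltW (p4 l))) /le_trans; apply.
  by have := eps_le1 l; lra.
(* Now [dist_int (4 ^+ l * t')] is at most [7/128 + 4/128 < 1/4], so the tent vanishes at [t']. *)
have dt' := dist_int_lipschitz (4 ^+ l * t') (4 ^+ l * t).
by move: bt0'; rewrite /tent_at tent_eq0 ?mulr0 ?ltxx//; lra.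
Qed.

(** One of the two points has coordinate 0 at level [i], so the other coordinate, times [eps i], is
    below [r]; passing from time [t0] to [t] adds at most [2 * r]. *)
Let flipped_bit_small t0 s0 r t s i : mdist (P t0 s0) (P t s) < r ->
  nth false s i != nth false s0 i -> tent_at i t * eps i < 3 * r.
Proof.
move=> d; have dt := P_time t0 t s0 s; have dc := P_crd t0 t s0 s i.
have r0 : 0 < r := le_lt_trans (mdist_ge0 _ _) d.
have dl : `|tent_at i t - tent_at i t0| <= 2 * r.
  by apply: le_trans (tent_at_lipschitz _ _ _) _; rewrite distrC; lra.
have tl : tent_at i t * eps i <= tent_at i t0 * eps i + 2 * r.
  have : (tent_at i t - tent_at i t0) * eps i <= 2 * r.
    apply: le_trans (ler_wpM2r (ltW (eps_gt0 i)) (le_trans (ler_norm _) dl)) _.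
    by rewrite ler_piMr// mulr_ge0// ltW.
  by lra.
case: (nth _ s i) dc => /=; case: (nth _ s0 i) => //= + _.
  by rewrite mul0r mul1r sub0r normrN ger0_norm ?tent_at_ge0//; lra.
by rewrite mul0r mul1r subr0 ger0_norm ?tent_at_ge0//; lra.
Qed.

(* [J] lists the levels below [m] whose size is comparable to [r], and the
   exceptional level [i0]. *)
Let close_of_bits t0 s0 r : 0 < r -> exists J : 5.-tuple nat, forall t s t' s',
  mdist (P t0 s0) (P t s) < r -> mdist (P t0 s0) (P t' s') < r ->
  (forall j, nth false s (tnth J j) = nth false s' (tnth J j)) ->
  mdist (P t s) (P t s') <= r / 6.
Proof.
move=> r0; have := delta_small (divr_gt0 r0 (ltr0n _ 2)).
move=> /ex_minnP[m dm m_min].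
have [i0 bad_i0] : exists i0, forall i, bad t0 r i -> i = i0.
  have [[i0 bi0]|nbad] := pselect (exists i, bad t0 r i).
    by exists i0 => i bi; exact: bad_unique bi bi0.
  by exists 0%N => i bi; case: nbad; exists i.
exists [tuple (m - 1)%N; (m - 2)%N; (m - 3)%N; (m - 4)%N; i0] => t s t' s' d d' ss'.
suff crdE i : (i < m)%N -> crd t s i = crd t s' i.
  by apply: le_trans (P_tail crdE) _; lra.
move=> im; have [->//|ne] := eqVneq (nth false s i) (nth false s' i).
have notJ j : i != tnth [tuple (m - 1)%N; (m - 2)%N; (m - 3)%N; (m - 4)%N; i0] j.
  by apply: contra ne => /eqP ->; rewrite ss'.
have im5 : (i + 5 <= m)%N.
  by move: (notJ 0) (notJ 1) (notJ 2) (notJ 3) => /eqP + /eqP + /eqP + /eqP +; rewrite /tnth/=; lia.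
have di : 128 * r < delta i.
  (* Minimality of [m] gives this bound; the four or more levels from [i] to [m.-1] gain a factor
     [4 ^+ 4 = 256]. *)
  have dm1 : r / 2 < delta m.-1.
    by rewrite ltNge; apply/negP => /m_min; lia.
  have := deltaD i (m.-1 - i); rewrite subnKC; last lia.
  have : 4 ^+ 4 <= 4 ^+ (m.-1 - i) :> R by rewrite ler_eXn2l ?ltr1n//; lia.
  have -> : 4 ^+ 4 = 256 :> R by rewrite -natrX.
  move=> h; have := ler_wpM2l (ltW (delta_gt0 m.-1)) h; lra.
have [->|t_neq0] := eqVneq (tent_at i t) 0; first by rewrite !mulr0.
exfalso; suff bi : bad t0 r i.
  by have /eqP := notJ 4; apply; exact: bad_i0.
split => //; exists t.
have dt := P_time t0 t s0 s; have dt' := P_time t0 t' s0 s'.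
have tp : 0 < tent_at i t by rewrite lt_neqAle eq_sym t_neq0 tent_at_ge0.
rewrite distrC; split => //; first by lra.
(* One of [s], [s'] differs from [s0] at [i]. If it is [s'], the bound [3 * r] holds at [t'], and
   moving to [t] costs at most [4 * r], hence [7 * r]. *)
have [e|ns] := eqVneq (nth false s i) (nth false s0 i); last first.
  by have := flipped_bit_small d ns; lra.
have ns' : nth false s' i != nth false s0 i by rewrite -e eq_sym.
have := flipped_bit_small d' ns'.
have dl : `|tent_at i t - tent_at i t'| <= 4 * r.
  apply: le_trans (tent_at_lipschitz _ _ _) _.
  by have := ler_distD t0 t t'; rewrite (distrC t t0); lra.
have : (tent_at i t - tent_at i t') * eps i <= 4 * r.
  apply: le_trans (ler_wpM2r (ltW (eps_gt0 i)) (le_trans (ler_norm _) dl)) _.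
  by rewrite ler_piMr// mulr_ge0// ltW.
by lra.
Qed.

Lemma doubling_of_coordinates : doubling (range (fun ts : R * seq bool => P ts.1 ts.2)).
Proof.
set A := range _.
have AP (y : A) : exists ts : R * seq bool, P ts.1 ts.2 = set_val y.
  by have [ts _ tsE] := set_valP y; exists ts.
(* Different bit sequences may give the same point, so one parameter is chosen for each point. *)
pose par y := sval (cid (AP y)).
have parE y : P (par y).1 (par y).2 = set_val y by exact: svalP (cid (AP y)).
apply: (@doubling_of_keys _ _ ('I_17 * {ffun 'I_5 -> bool})%type (ord0, [ffun=> false])).
move=> x r r0; have [J closeJ] := close_of_bits (par x).1 (par x).2 r0.
(* Times in the ball lie within [2 * r] of that of the centre; this interval is cut into 16 cells of
   length [r / 4], whose indices fit in ['I_17]. *)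
pose cell t := ((t - (par x).1 + 2 * r) / (r / 4) : R).
exists (fun y => (inord (Num.truncn (cell (par y).1)),
  [ffun j => nth false (par y).2 (tnth J j)])) => y z.
rewrite /mdist/= -!parE => xy xz [cellE /ffunP bitE].
have dt := P_time (par x).1 (par y).1 (par x).2 (par y).2.
have dt' := P_time (par x).1 (par z).1 (par x).2 (par z).2.
have cell_itv t : `|(par x).1 - t| < 2 * r -> 0 <= cell t < 16.
  rewrite ltr_norml => /andP[t1 t2]; rewrite /cell ltr_pdivrMr ?divr_gt0//.
  by rewrite divr_ge0 ?divr_ge0 ?(ltW r0)//=; lra.
have cy : 0 <= cell (par y).1 < 16 by apply: cell_itv; lra.
have cz : 0 <= cell (par z).1 < 16 by apply: cell_itv; lra.
have truncE (c : R) : 0 <= c < 16 ->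
    [/\ (Num.truncn c < 17)%N, (Num.truncn c)%:R <= c & c < (Num.truncn c)%:R + 1].
  move=> /andP[c0 c16]; have /andP[tc ct] := truncn_itv c0.
  split=> //; last by rewrite natr1.
  by have := le_lt_trans tc c16; rewrite (ltr_nat R _ 16) => /ltnW.
have yz : `|(par y).1 - (par z).1| <= r / 4.
  have [ty ty1 ty2] := truncE _ cy; have [tz tz1 tz2] := truncE _ cz.
  have tE : Num.truncn (cell (par y).1) = Num.truncn (cell (par z).1).
    by rewrite -(inordK ty) cellE inordK.
  rewrite tE in ty1 ty2.
  have : `|cell (par y).1 - cell (par z).1| <= 1 by rewrite ler_norml; lra.
  rewrite -mulrBl normrM (gtr0_norm (_ : 0 < (r / 4)^-1)) ?invr_gt0 ?divr_gt0//.
  rewrite ler_pdivrMr ?divr_gt0// mul1r; congr (`|_| <= _); lra.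
have bits j : nth false (par y).2 (tnth J j) = nth false (par z).2 (tnth J j).
  by have := bitE j; rewrite !ffunE.
(* Changing the bits at fixed time costs [r / 6], then changing the time [r / 4]: less than [r / 2]
   in total. *)
have := closeJ _ _ _ _ xy xz bits.
have := metric_triangle (P (par y).1 (par y).2) (P (par y).1 (par z).2) (P (par z).1 (par z).2).
have := P_lip (par y).1 (par z).1 (par z).2.
by lra.
Qed.

End doubling_of_coordinates.

(** * Euclidean distortion *)

Section no_euclidean_embedding.
Variable R : realType.

Lemma sqr_euclidean_dist k (x y : euclidean R k) :
  mdist x y ^+ 2 = \sum_(i < k) ((x : 'rV[R]_k) 0 i - (y : 'rV[R]_k) 0 i) ^+ 2.
Proof. by rewrite [mdist _ _]/(euclidean_dist x y) sqr_sqrtr// sumr_ge0// => i _; exact: sqr_ge0. Qed.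

(* The parallelogram-type inequality for the quadrilateral [a b d c], combined
   with convexity of the square along [u a d v] with weights 1/4, 1/2, 1/4. *)
Lemma euclidean_diamond k (u a b c d v : euclidean R k) :
  mdist u v ^+ 2 + 2 * mdist b c ^+ 2 <=
  4 * mdist u a ^+ 2 + 4 * mdist d v ^+ 2 +
  2 * (mdist a b ^+ 2 + mdist a c ^+ 2 + mdist b d ^+ 2 + mdist c d ^+ 2).
Proof.
rewrite !sqr_euclidean_dist -!big_split/= !mulr_sumr -!big_split/=.
apply: ler_sum => i _.
move: (u 0 i) (a 0 i) (b 0 i) (c 0 i) (d 0 i) (v 0 i) => {}u {}a {}b {}c {}d {}v.
have := sqr_ge0 (a + d - b - c); have := sqr_ge0 ((a - d) - 2 * (u - a)).
have := sqr_ge0 ((d - v) - (u - a)); have := sqr_ge0 (2 * (d - v) - (a - d)).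
by nra.
Qed.

Variables (X : metricType R) (P : R -> seq bool -> X) (eps : nat -> R).
Hypothesis eps_gt0 : forall i, 0 < eps i.
Hypothesis eps_dvg : forall C, exists n, C < \sum_(i < n) eps i ^+ 2.

Local Notation crd t s i := ((nth false s i)%:R * tent_at i t).

Hypothesis P_lip : forall t t' s, mdist (P t s) (P t' s) <= `|t - t'|.
Hypothesis P_crd : forall t t' s s' i,
  `|crd t s i - crd t' s' i| * eps i <= mdist (P t s) (P t' s').
Hypothesis P_sum : forall t s s', mdist (P t s) (P t s') <=
  \sum_(i < maxn (size s) (size s')) `|crd t s i - crd t s' i| * eps i.

Let P_eq t s s' : (forall i, crd t s i = crd t s' i) -> P t s = P t s'.
Proof.
move=> ss'; apply: mdist_positivity; apply/eqP; rewrite eq_le mdist_ge0 andbT.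
apply: le_trans (P_sum _ _ _) _; rewrite big1// => i _.
by rewrite ss' subrr normr0 mul0r.
Qed.

Let node n q : R := q%:R / 4 ^+ n.

Let p4 i : 4 ^+ i != 0 :> R.
Proof. by rewrite expf_neq0. Qed.

Let nodeS n q : node n q = node n.+1 (4 * q).
Proof. by rewrite /node natrM exprS; field. Qed.

Let node_scale n q j : 4 ^+ n * node n.+1 (4 * q + j) = q%:R + j%:R / 4.
Proof. by rewrite /node natrD natrM exprS; field. Qed.

(** Of the five nodes dividing a segment of level [n], only the midpoint [j = 2] lies in the support
    of [tent_at n]. So the two paths given by bit [n] share all other nodes and form a diamond. *)
Let P_flip n q j s b : (j != 2)%N -> (j <= 4)%N ->
  P (node n.+1 (4 * q + j)) (set_nth false s n b) = P (node n.+1 (4 * q + j)) s.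
Proof.
move=> j2 j4; apply: P_eq => i; rewrite nth_set_nth/=; case: eqP => [->|//].
rewrite [tent_at _ _](_ : _ = 0) ?mulr0// /tent_at node_scale.
case: j j2 j4 => [|[|[|[|[|]]]]]//= _ _; rewrite ?mul0r ?addr0 ?mul1r.
- by rewrite tent_nat mulr0.
- by rewrite tent_quarter mulr0.
- by rewrite tent_three_quarters mulr0.
- by rewrite divff// natr1 tent_nat mulr0.
Qed.

Lemma no_euclidean_embedding k :
  ~ bilipschitz_embeds (range (fun ts : R * seq bool => P ts.1 ts.2)) (euclidean R k).
Proof.
move=> [f [c [M [c0 [M1 fP]]]]].
pose A := range (fun ts : R * seq bool => P ts.1 ts.2).
have AP t s : P t s \in A by apply/mem_set; exists (t, s).
(* Extending [f] by 0 avoids membership proofs in what follows. *)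
pose F x : euclidean R k := if pselect (x \in A) is left xA then f (SigSub xA) else 0.
have FP t s t' s' : c * mdist (P t s) (P t' s') <= mdist (F (P t s)) (F (P t' s'))
    <= M * c * mdist (P t s) (P t' s').
  rewrite /F; case: pselect => [xA|//]; case: pselect => [yA|//].
  exact: (fP (SigSub xA) (SigSub yA)).
(* The squared stretch on a segment: [16 ^+ n] is the inverse square of its time length [4 ^- n]. *)
pose E n q s := 16 ^+ n * mdist (F (P (node n q) s)) (F (P (node n q.+1) s)) ^+ 2.
have E_le n q s : E n q s <= (M * c) ^+ 2.
  have /andP[_ h] := FP (node n q) s (node n q.+1) s.
  have l4 : mdist (P (node n q) s) (P (node n q.+1) s) <= (4 ^+ n)^-1.
    apply: le_trans (P_lip _ _ _) _.
    by rewrite /node -mulrBl -natr1 opprD addrA subrr sub0r mulN1r normrN ger0_norm.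
  have Mc : 0 <= M * c by rewrite mulr_ge0 ?(ltW c0)// (le_trans ler01).
  have := le_trans h (ler_wpM2l Mc l4).
  rewrite ler_pdivlMr ?exprn_gt0// => h4.
  rewrite /E (_ : 16 = 4 ^+ 2 :> R); last by rewrite -natrX.
  rewrite -exprM mulnC exprM -exprMn ler_sqr ?nnegrE// 1?mulrC//.
  by rewrite mulr_ge0 ?mdist_ge0 ?exprn_ge0.
have E_ge n : exists q s, c ^+ 2 / 8 * \sum_(i < n) eps i ^+ 2 <= E n q s.
  elim: n => [|n [q [s IH]]].
    exists 0%N, [::]; rewrite big_ord0 mulr0 /E mulr_ge0 ?sqr_ge0 ?exprn_ge0//.
  (* If every segment of level [n.+1] stayed below the bound, the diamond over segment [q] would be
     too thin. *)
  apply: contrapT => /forallNP noE.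
  have Elt q' s' : E n.+1 q' s' < c ^+ 2 / 8 * \sum_(i < n.+1) eps i ^+ 2.
    rewrite ltNge; apply/negP => h; apply: (noE q'); by exists s'.
  pose s0 := set_nth false s n false; pose s1 := set_nth false s n true.
  pose g j s' := F (P (node n.+1 (4 * q + j)) s').
  have := euclidean_diamond (g 0 s) (g 1 s) (g 2 s0) (g 2 s1) (g 3 s) (g 4 s).
  have bc : c * (4 ^- n / 4 * eps n) <= mdist (g 2 s0) (g 2 s1).
    have /andP[+ _] := FP (node n.+1 (4 * q + 2)) s0 (node n.+1 (4 * q + 2)) s1.
    apply: le_trans; rewrite ler_pM2l//; apply: le_trans (P_crd _ _ _ _ n).
    rewrite !nth_set_nth/= eqxx mul0r sub0r mul1r normrN /tent_at node_scale.
    have -> : 2 / 4 = 2^-1 :> R by field.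
    by rewrite tent_half ger0_norm// mulr_ge0// invr_ge0// exprn_ge0.
  have edge j s' : 16 ^+ n.+1 * mdist (g j s') (g j.+1 s') ^+ 2 <
      c ^+ 2 / 8 * \sum_(i < n.+1) eps i ^+ 2.
    by have := Elt (4 * q + j)%N s'; rewrite /E -addnS.
  have g_flip j b : (j != 2)%N -> (j <= 4)%N -> g j (set_nth false s n b) = g j s.
    by move=> j2 j4; rewrite /g P_flip.
  have g1 b : g 1 (set_nth false s n b) = g 1 s by exact: g_flip.
  have g3 b : g 3 (set_nth false s n b) = g 3 s by exact: g_flip.
  have ua := edge 0 s; have dv := edge 3 s.
  have := edge 1 s0; have := edge 1 s1; rewrite !g1 => ac ab.
  have := edge 2 s0; have := edge 2 s1; rewrite !g3 => cd bd.
  have uv : c ^+ 2 / 8 * \sum_(i < n) eps i ^+ 2 <= 16 ^+ n * mdist (g 0 s) (g 4 s) ^+ 2.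
    by move: IH; rewrite /E (nodeS n q) (nodeS n q.+1) mulnS addnC /g addn0.
  have e16 : 16 ^+ n = (4 ^+ n) ^+ 2 :> R.
    by rewrite -exprM mulnC exprM; congr (_ ^+ n); rewrite -natrX.
  have bc2 : c ^+ 2 * eps n ^+ 2 <= 16 * (16 ^+ n * mdist (g 2 s0) (g 2 s1) ^+ 2).
    move: bc; set m := mdist _ _.
    have -> : c * (4 ^- n / 4 * eps n) = c * eps n / (4 * 4 ^+ n) by field.
    rewrite ler_pdivrMr ?mulr_gt0 ?exprn_gt0// => h.
    have -> : c ^+ 2 * eps n ^+ 2 = (c * eps n) ^+ 2 by rewrite exprMn.
    have -> : 16 * (16 ^+ n * m ^+ 2) = (m * (4 * 4 ^+ n)) ^+ 2.
      by rewrite e16; ring.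
    by rewrite ler_sqr// nnegrE mulr_ge0 ?mdist_ge0 ?mulr_ge0 ?exprn_ge0 ?(ltW c0) ?ltW.
  have pn : 0 <= 16 ^+ n :> R by rewrite exprn_ge0.
  move=> /(ler_wpM2l pn).
  (* The weights of the six edges add up to [4 + 4 + 4 * 2 = 16], the ratio of [16 ^+ n.+1] to
     [16 ^+ n]. The diagonal, with weight 2, contributes [2 / 16] of [c ^+ 2 * eps n ^+ 2], whence
     the factor 1/8. *)
  move: uv bc2 ua dv ab ac bd cd; rewrite big_ord_recr/= [16 ^+ n.+1]exprS; lra.
(* Chosen so that [c ^+ 2 / 8] times the sum exceeds [(M * c) ^+ 2]. *)
have [n nC] := eps_dvg (8 * M ^+ 2).
have [q [s nE]] := E_ge n.
have := le_trans nE (E_le n q s).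
rewrite exprMn mulrC; have c2 : 0 < c ^+ 2 by rewrite exprn_gt0.
have := nC; rewrite -(ltr_pM2l c2); lra.
Qed.

End no_euclidean_embedding.

(** * The fractal inside L_p *)

Section zigzag.
Variables (R : realType) (p : R) (p2 : 2 < p) (w : nat -> R).
Hypothesis w_gt0 : forall i, 0 < w i.
Hypothesis sum_w : forall n, \sum_(i < n) w i <= 2^-1.

(** Index 0 is J_0, which carries the time; level [i] sits at index [i.+1]. *)
Definition weight i : R := if i is j.+1 then w j else 2^-1.

Let weight_ge0 i : 0 <= weight i.
Proof. by case: i => [|i] /=; rewrite ?invr_ge0// ltW. Qed.

Let sum_weight n : \sum_(i < n) weight i <= 1.
Proof.
case: n => [|n]; first by rewrite big_ord0.
by rewrite big_ord_recl/=; have := sum_w n; lra.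
Qed.

Definition zigzag (t : R) (s : seq bool) : Lp01 (lee1_gt2 p2) :=
  step_class weight_ge0 (lee1_gt2 p2)
    (t :: mkseq (fun i => (nth false s i)%:R * tent_at i t) (size s)).

Let nth_crd (t : R) s i :
  (mkseq (fun i => (nth false s i)%:R * tent_at i t) (size s))`_i =
  (nth false s i)%:R * tent_at i t.
Proof.
have [si|si] := ltnP i (size s); first by rewrite nth_mkseq.
by rewrite !nth_default ?size_mkseq// mul0r.
Qed.

Lemma zigzag_lipschitz t t' s : mdist (zigzag t s) (zigzag t' s) <= `|t - t'|.
Proof.
apply: mdist_step_class_le => -[|i] //=; rewrite !nth_crd -mulrBr normrM.
apply: le_trans (tent_at_lipschitz i t t'); rewrite ler_piMl//.
by case: (nth _ _ _); rewrite ?normr1 ?normr0.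
Qed.

(** The factor 2 makes up for the length 1/2 of J_0, whose p-th root is at least 1/2. *)
Lemma zigzag_time t t' s s' : `|t - t'| <= 2 * mdist (zigzag t s) (zigzag t' s').
Proof.
have := mdist_step_class_ge weight_ge0 sum_weight (lee1_gt2 p2)
  (t :: mkseq (fun i => (nth false s i)%:R * tent_at i t) (size s))
  (t' :: mkseq (fun i => (nth false s' i)%:R * tent_at i t') (size s')) 0.
rewrite /= -/(zigzag t s) -/(zigzag t' s').
have : 2^-1 <= 2^-1 `^ p^-1 :> R.
  rewrite -[leLHS]powRr1// ger_powR//; first by lra.
  by rewrite invf_le1//; move: p2; lra.
move=> /(ler_wpM2l (normr_ge0 (t - t'))); lra.
Qed.

Lemma zigzag_crd t t' s s' i :
  `|(nth false s i)%:R * tent_at i t - (nth false s' i)%:R * tent_at i t'|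
    * w i `^ p^-1 <= mdist (zigzag t s) (zigzag t' s').
Proof.
have := mdist_step_class_ge weight_ge0 sum_weight (lee1_gt2 p2)
  (t :: mkseq (fun i => (nth false s i)%:R * tent_at i t) (size s))
  (t' :: mkseq (fun i => (nth false s' i)%:R * tent_at i t') (size s')) i.+1.
by rewrite /= !nth_crd.
Qed.

Lemma zigzag_sum t s s' : mdist (zigzag t s) (zigzag t s') <=
  \sum_(i < maxn (size s) (size s'))
    `|(nth false s i)%:R * tent_at i t - (nth false s' i)%:R * tent_at i t|
      * w i `^ p^-1.
Proof.
apply: (le_trans (mdist_step_class_le_sum weight_ge0 sum_weight _ (leqnn _))).
(* The time entries agree, so index 0 drops out and the levels shift down by one. *)
rewrite /= !size_mkseq maxnSS big_ord_recl/= subrr normr0 mul0r add0r.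
by apply: ler_sum => i _; rewrite !nth_crd.
Qed.

End zigzag.

Theorem theorem1p1 (R : realType) (p : R) (p2 : 2 < p) :
  exists A : set (Lp01 (lee1_gt2 p2)),
    doubling A /\ forall k : nat, ~ bilipschitz_embeds A (euclidean R k).
Proof.
have [w [w_gt0 w_decr sum_w w_dvg]] := exists_weights p2.
have p0 : 0 < p by lra.
have pV : 0 <= p^-1 by rewrite invr_ge0 ltW.
pose eps i := w i `^ p^-1.
have eps_gt0 i : 0 < eps i by rewrite powR_gt0.
have eps_decr i : eps i.+1 <= eps i.
  by rewrite ge0_ler_powR// nnegrE ltW.
have eps_le1 i : eps i <= 1.
  have w1 : w i <= 1.
    have := sum_w i.+1; rewrite big_ord_recr/=.
    have : 0 <= \sum_(j < i) w j by apply: sumr_ge0 => j _; rewrite ltW.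
    by lra.
  have := ge0_ler_powR pV _ _ w1; rewrite !nnegrE powR1; apply => //.
  exact: ltW.
exists (range (fun ts : R * seq bool => zigzag p2 w_gt0 ts.1 ts.2)); split.
  apply: (doubling_of_coordinates eps_gt0 eps_le1 eps_decr).
  - exact: zigzag_lipschitz.
  - exact: zigzag_time.
  - exact: zigzag_crd.
  - exact: zigzag_sum.
apply: (no_euclidean_embedding eps_gt0 w_dvg).
- exact: zigzag_lipschitz.
- exact: zigzag_crd.
- exact: zigzag_sum.
Qed.
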